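(* Let $n,k\ge1$, let $A_0$ be an $n\times k$ real matrix of rank $k$, $a$ a $1\times k$ real row vector, $A_1=\begin{bmatrix}A_0\\ a\end{bmatrix}$, and let $Y_1,\dots,Y_{n+1}$ follow the linear model described in the context. If the random variables $Y_1,\dots,Y_{n+1}$ are uncorrelated, $\mathrm{var}(Y_i)=\sigma_1^2$ for $i=1,\dots,n$, and $\mathrm{var}(Y_{n+1})=\sigma_{n+1}^2$ with $\sigma_1^2>\sigma_{n+1}^2$, then the ordinary least squares estimators have the variance reduction property: $$V_{11}(i,i)\le V_{00}(i,i)\qquad\text{for all } i\in\{1,\dots,k\}.$$
   Context: Model: $\mathbf{Y}_0=(Y_1,\dots,Y_n)^T=A_0\beta+\epsilon_0$ and $\mathbf{Y}_1=(Y_1,\dots,Y_{n+1})^T=A_1\beta+\epsilon_1$, where $\beta\in\mathbb{R}^k$ is an unknown parameter vector, $\epsilon_0$ consists of the first $n$ components of $\epsilon_1$, $E(\epsilon_1)=0$ and $\mathrm{Cov}(\epsilon_1)=\mathbf{\Sigma}_{11}$; $\mathbf{\Sigma}_{00}$ denotes the covariance matrix of $\mathbf{Y}_0$. With $A_{00}=A_0^TA_0$ and $A_{11}=A_1^TA_1$, the ordinary least squares (OLS) estimators based on $n$ and $n+1$ observations are $\hat\beta_0=A_{00}^{-1}A_0^T\mathbf{Y}_0$ and $\hat\beta_1=A_{11}^{-1}A_1^T\mathbf{Y}_1$; their covariance matrices are $$V_{00}=A_{00}^{-1}A_0^T\mathbf{\Sigma}_{00}A_0A_{00}^{-1},\qquad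 V_{11}=A_{11}^{-1}A_1^T\mathbf{\Sigma}_{11}A_1A_{11}^{-1}.$$ *)

(* Defs.v *)
From HB Require Import structures.
From mathcomp Require Import all_boot all_order all_algebra.
From mathcomp Require Import all_classical all_reals all_analysis.

Set Implicit Arguments.
Unset Strict Implicit.
Unset Printing Implicit Defensive.

Import Order.TTheory GRing.Theory Num.Theory.

Local Open Scope ring_scope.

Definition rv_coord (T : Type) (R : Type) (m : nat) (X : T -> 'cV[R]_m)
  (i : 'I_m) : T -> R := fun w => X w i ord0.

(* Entries are extended reals because the library's [covariance] is; they are
   finite as soon as the coordinates of [X] are square integrable. *)
Definition cov_mx (d : measure_display) (T : measurableType d) (R : realType)
    (P : probability T R) (m : nat) (X : T -> 'cV[R]_m) : 'M[\bar R]_m :=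
  \matrix_(i, j) covariance P (rv_coord X i) (rv_coord X j).

(* [Lfun P 2%:E] contains the measurability of the errors, and the finite second
   moments without which their covariance matrix is meaningless. *)
Record linear_model (d : measure_display) (T : measurableType d) (R : realType)
    (P : probability T R) (m k : nat) (A : 'M[R]_(m, k)) (beta : 'cV[R]_k)
    (Sigma : 'M[R]_m) (eps Y : T -> 'cV[R]_m) : Prop := LinearModel {
  lm_eq : forall w, Y w = A *m beta + eps w;
  lm_L2 : forall i, rv_coord eps i \in Lfun P 2%:E;
  lm_mean : forall i, ('E_P[rv_coord eps i] = 0)%E;
  lm_cov : cov_mx P eps = map_mx EFin Sigma }.

(* The inverse is meaningful when [A] has full column rank. *)
Definition ols (R : realType) (m k : nat) (A : 'M[R]_(m, k)) (y : 'cV[R]_m) :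
  'cV[R]_k := invmx (A^T *m A) *m A^T *m y.

Lemma rv_coord_mul (T : Type) (R : realType) (m k : nat) (B : 'M[R]_(k, m))
    (X : T -> 'cV[R]_m) (i : 'I_k) :
  rv_coord (fun w => B *m X w) i = \sum_j B i j \o* rv_coord X j.
Proof.
apply/funext => w; rewrite fct_sumE /rv_coord mxE.
by apply: eq_bigr => j _; rewrite /= mulrC.
Qed.

Lemma Lfun2_comb (d : measure_display) (T : measurableType d) (R : realType)
    (P : probability T R) (m : nat) (b : 'I_m -> R) (X : 'I_m -> T -> R) :
  (forall j, X j \in Lfun P 2%:E) -> \sum_j b j \o* X j \in Lfun P 2%:E.
Proof.
move=> X2; elim/big_ind: _ => [|f g f2 g2|j _]; first exact: Lfun_cst.
- by rewrite rpredD ?lee1n.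
- by rewrite Lfun_scale ?ler1n.
Qed.

Lemma covariance_suml (d : measure_display) (T : measurableType d)
    (R : realType) (P : probability T R) (m : nat) (b : 'I_m -> R)
    (X : 'I_m -> T -> R) (Z : T -> R) :
  (forall j, X j \in Lfun P 2%:E) -> Z \in Lfun P 2%:E ->
  covariance P (\sum_j b j \o* X j) Z =
  (\sum_j (b j)%:E * covariance P (X j) Z)%E.
Proof.
move=> X2 Z2.
have Pfin : P setT \is a fin_num := fin_num_measure P _ measurableT.
apply: proj2 (_ : (\sum_j b j \o* X j \in Lfun P 2%:E) /\ _).
elim/big_ind2 : _ => [|u f v g [f2 <-] [g2 <-]|j _].
- by split; [exact: Lfun_cst|exact: covariance_cst_l].
- by split; [rewrite rpredD ?lee1n|rewrite covarianceDl].
- split; first by rewrite Lfun_scale ?ler1n.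
  by rewrite covarianceZl ?Lfun2_mul_Lfun1 ?Lfun_subset12.
Qed.

Lemma cov_mx_mul (d : measure_display) (T : measurableType d) (R : realType)
    (P : probability T R) (m k : nat) (B : 'M[R]_(k, m)) (Sigma : 'M[R]_m)
    (X : T -> 'cV[R]_m) :
  (forall i, rv_coord X i \in Lfun P 2%:E) -> cov_mx P X = map_mx EFin Sigma ->
  cov_mx P (fun w => B *m X w) = map_mx EFin (B *m Sigma *m B^T).
Proof.
move=> X2 covX; apply/matrixP => i j; rewrite !mxE !rv_coord_mul.
have BX2 l : \sum_j0 B l j0 \o* rv_coord X j0 \in Lfun P 2%:E.
  exact: Lfun2_comb.
have covE l r : covariance P (rv_coord X l) (rv_coord X r) = (Sigma l r)%:E.
  by move/matrixP/(_ l r): covX; rewrite !mxE.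
rewrite covariance_suml//.
transitivity (\sum_l (B i l * \sum_r B j r * Sigma l r)%:E)%E.
  apply: eq_bigr => l _; rewrite covarianceC covariance_suml// EFinM -sumEFin.
  by congr *%E; apply: eq_bigr => r _; rewrite covarianceC covE EFinM.
rewrite sumEFin; congr EFin.
under eq_bigr do rewrite mulr_sumr.
rewrite exchange_big; apply: eq_bigr => r _ /=; rewrite !mxE mulr_suml.
by apply: eq_bigr => l _; rewrite (mulrC (B j r)) mulrA.
Qed.

Lemma cov_mx_addl (d : measure_display) (T : measurableType d) (R : realType)
    (P : probability T R) (m : nat) (b : 'cV[R]_m) (X : T -> 'cV[R]_m) :
  (forall i, rv_coord X i \in Lfun P 2%:E) ->
  cov_mx P (fun w => b + X w) = cov_mx P X.
Proof.
move=> X2; apply/matrixP => i j; rewrite !mxE.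
have cE l : rv_coord (fun w => b + X w) l = cst (b l ord0) \+ rv_coord X l.
  by apply/funext => w; rewrite /rv_coord mxE.
have c2 l : cst (b l ord0) \in Lfun P 2%:E by exact: Lfun_cst.
have bX2 l : cst (b l ord0) \+ rv_coord X l \in Lfun P 2%:E.
  by rewrite rpredD ?lee1n.
rewrite !cE covarianceDl// covariance_cst_l add0e.
by rewrite covarianceDr// covariance_cst_r add0e.
Qed.

Lemma cov_mx_ols (d : measure_display) (T : measurableType d) (R : realType)
    (P : probability T R) (m k : nat) (A : 'M[R]_(m, k)) (beta : 'cV[R]_k)
    (Sigma : 'M[R]_m) (eps Y : T -> 'cV[R]_m) :
  linear_model P A beta Sigma eps Y ->
  cov_mx P (fun w => ols A (Y w)) =
  map_mx EFin (invmx (A^T *m A) *m A^T *m Sigma *m A *m invmx (A^T *m A)).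
Proof.
case=> YE e2 _ coveps.
have -> : (fun w => ols A (Y w)) =
    (fun w => (ols A (A *m beta)) + (invmx (A^T *m A) *m A^T) *m eps w).
  by apply/funext => w; rewrite /ols YE mulmxDr.
rewrite cov_mx_addl => [|i]; last first.
  by rewrite rv_coord_mul Lfun2_comb.
rewrite (cov_mx_mul _ e2 coveps); congr map_mx.
by rewrite trmx_mul trmxK trmx_inv trmx_mul trmxK !mulmxA.
Qed.

Lemma linear_model_usub (d : measure_display) (T : measurableType d)
    (R : realType) (P : probability T R) (m n k : nat) (A : 'M[R]_(m, k))
    (B : 'M[R]_(n, k)) (beta : 'cV[R]_k) (Sigma : 'M[R]_(m + n))
    (eps Y : T -> 'cV[R]_(m + n)) :
  linear_model P (col_mx A B) beta Sigma eps Y ->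
  linear_model P A beta (ulsubmx Sigma)
    (fun w => usubmx (eps w)) (fun w => usubmx (Y w)).
Proof.
case=> YE e2 e0 coveps.
have cE i : rv_coord (fun w => usubmx (eps w)) i = rv_coord eps (lshift n i).
  by apply/funext => w; rewrite /rv_coord mxE.
split=> [w|i|i|]; [|by rewrite cE|by rewrite cE|].
- by rewrite YE mul_col_mx linearD /= col_mxKu.
- apply/matrixP => i j; move/matrixP/(_ (lshift n i) (lshift n j)): coveps.
  by rewrite !mxE !cE.
Qed.

(* Main.v *)
Require Import Defs.
From mathcomp Require Import all_boot all_order all_algebra.
From mathcomp Require Import all_classical all_reals all_analysis.
From mathcomp Require Import ring lra.

Set Implicit Arguments.
Unset Strict Implicit.
Unset Printing Implicit Defensive.

Import Order.TTheory GRing.Theory Num.Theory.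

Local Open Scope ring_scope.

(** Write [s] and [t] for the variances of the first [n] observations and of
    the last one, [M := A0^T A0] and [N := A1^T A1 = M + a^T a]. The covariance
    matrix of the observations is the block-diagonal matrix with blocks
    [s I_n] and [t], so
    [V00 = s M^-1] and [V11 = N^-1 (s M + t a^T a) N^-1].
    With [W := M^-1 - N^-1], the relation [N - M = a^T a] gives the identity
    ([ols_variance_gap])
    [V00 - V11 = s W A0^T A0 W^T + (2 s - t) (N^-1 a^T) (N^-1 a^T)^T].
    Both terms are nonnegative multiples of matrices [B B^T], whose diagonal
    entries are sums of squares; here [2 s - t >= 0] because [t < s]. Hence
    [V00 - V11] has a nonnegative diagonal. *)

Lemma mulmx_trmx_diag_ge0 (R : realDomainType) (m n : nat) (B : 'M[R]_(m, n))
    (i : 'I_m) : 0 <= (B *m B^T) i i.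
Proof.
rewrite mxE; apply: sumr_ge0 => j _.
by rewrite mxE -expr2 sqr_ge0.
Qed.

Lemma mulmx_trmx_eq0 (R : realDomainType) (n : nat) (u : 'rV[R]_n) :
  u *m u^T = 0 -> u = 0.
Proof.
move=> /matrixP/(_ ord0 ord0); rewrite !mxE => uu0.
apply/rowP => j; rewrite mxE; apply/eqP; rewrite -sqrf_eq0; apply/eqP.
have sq l : u ord0 l ^+ 2 = u ord0 l * u^T l ord0 by rewrite mxE expr2.
rewrite sq; apply: (psumr_eq0P _ uu0) => // l _.
by rewrite -sq sqr_ge0.
Qed.

(** If [v] kills [A^T A] then [(v A^T) (v A^T)^T = 0], so [v A^T = 0] because
    the scalars are ordered; full column rank then forces [v = 0]. *)
Lemma gram_unitmx (R : realFieldType) (m k : nat) (A : 'M[R]_(m, k)) :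
  row_free A^T -> A^T *m A \in unitmx.
Proof.
move=> freeA; rewrite -row_free_unit -kermx_eq0; apply/eqP/row_matrixP => i.
rewrite row0; set v := row i _.
have vG0 : v *m (A^T *m A) = 0.
  by rewrite /v -row_mul mulmx_ker row0.
apply/(row_free_inj freeA); rewrite mul0mx; apply: mulmx_trmx_eq0.
by rewrite trmx_mul trmxK mulmxA -[X in X *m _]mulmxA vG0 mul0mx.
Qed.

Lemma row_free_tr_col_mx (R : fieldType) (m p k : nat) (A : 'M[R]_(m, k))
    (B : 'M[R]_(p, k)) : row_free A^T -> row_free (col_mx A B)^T.
Proof.
move=> /row_freeP[C AC]; apply/row_freeP; exists (col_mx C 0).
by rewrite tr_col_mx mul_row_col mulmx0 addr0.
Qed.

(** Put [M := A^T A], [N := A1^T A1] and [Q := N^-1 B^T B N^-1]. Since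
    [N - M = B^T B], one has [N^-1 M N^-1 = N^-1 - Q]. Expanding
    [W W^T = (M^-1 - N^-1) M (M^-1 - N^-1)] with this rule gives
    [M^-1 - N^-1 - Q], and the two covariances are [s M^-1] and
    [s (N^-1 - Q) + t Q]; the two sides then agree. *)
Lemma ols_variance_gap (R : realFieldType) (m p k : nat) (A : 'M[R]_(m, k))
    (B : 'M[R]_(p, k)) (s t : R) :
  row_free A^T ->
  let A1 := col_mx A B in
  let M' := invmx (A^T *m A) in
  let N' := invmx (A1^T *m A1) in
  let W := (M' - N') *m A^T in
  M' *m A^T *m s%:M *m A *m M'
    - N' *m A1^T *m block_mx s%:M 0 0 t%:M *m A1 *m N' =
  s *: (W *m W^T) + (s *+ 2 - t) *: ((N' *m B^T) *m (N' *m B^T)^T).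
Proof.
move=> freeA A1 M' N' W.
have Mu := gram_unitmx freeA.
have Nu := gram_unitmx (row_free_tr_col_mx B freeA).
have M'T : M'^T = M' by rewrite /M' trmx_inv trmx_mul trmxK.
have N'T : N'^T = N' by rewrite /N' trmx_inv trmx_mul trmxK.
have NE : A1^T *m A1 = A^T *m A + B^T *m B by rewrite tr_col_mx mul_row_col.
have N'M : N' *m (A^T *m A) = 1%:M - N' *m (B^T *m B).
  by rewrite -(mulVmx Nu) -/A1 -/N' NE mulmxDr addrK.
have M'M : M' *m (A^T *m A) = 1%:M by rewrite mulVmx.
have MM' : (A^T *m A) *m M' = 1%:M by rewrite mulmxV.
pose Q := N' *m (B^T *m B) *m N'.
have N'MN' : N' *m (A^T *m A) *m N' = N' - Q.
  by rewrite N'M mulmxBl mul1mx.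
have V0E : M' *m A^T *m s%:M *m A *m M' = s *: M'.
  by rewrite mul_mx_scalar -!scalemxAl -[_ *m A]mulmxA M'M mul1mx.
have V1E : N' *m A1^T *m block_mx s%:M 0 0 t%:M *m A1 *m N' =
           s *: (N' - Q) + t *: Q.
  rewrite -N'MN' tr_col_mx -[_ *m row_mx _ _ *m _]mulmxA mul_row_block !mulmx0.
  rewrite addr0 add0r !mul_mx_scalar -[_ *m A1]mulmxA mul_row_col.
  by rewrite -!scalemxAl mulmxDr -!scalemxAr mulmxDl -!scalemxAl.
have WE : W *m W^T = M' - N' - Q.
  rewrite /W trmx_mul trmxK linearB /= M'T N'T mulmxA -[_ *m _ *m A]mulmxA.
  rewrite mulmxBl M'M mulmxBl mul1mx mulmxBr -[N' *m _ *m M']mulmxA MM' mulmx1.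
  rewrite N'MN' !opprB addrA.
  by apply/matrixP => i j; rewrite !mxE; lra.
rewrite V0E V1E WE trmx_mul trmxK N'T.
have -> : N' *m B^T *m (B *m N') = Q by rewrite /Q !mulmxA.
by apply/matrixP => i j; rewrite !mxE; ring.
Qed.

Theorem corollary1 (R : realType) (d : measure_display) (T : measurableType d)
    (P : probability T R) (n k : nat)
    (A0 : 'M[R]_(n, k)) (a : 'rV[R]_k) (beta : 'cV[R]_k)
    (Sigma11 : 'M[R]_(n + 1)) (eps1 Y1 : T -> 'cV[R]_(n + 1))
    (sigma1 sigma_last : R) :
  (1 <= n)%N -> (1 <= k)%N ->
  \rank A0 = k ->
  let A1 : 'M[R]_(n + 1, k) := col_mx A0 a in
  linear_model P A1 beta Sigma11 eps1 Y1 ->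
  (forall i j : 'I_(n + 1), i != j ->
     covariance P (rv_coord Y1 i) (rv_coord Y1 j) = 0%E) ->
  (forall i : 'I_n, variance P (rv_coord Y1 (lshift 1 i)) = (sigma1 ^+ 2)%:E) ->
  variance P (rv_coord Y1 (rshift n ord0)) = (sigma_last ^+ 2)%:E ->
  sigma_last ^+ 2 < sigma1 ^+ 2 ->
  let Y0 : T -> 'cV[R]_n := fun w => usubmx (Y1 w) in
  let V00 := cov_mx P (fun w => ols A0 (Y0 w)) in
  let V11 := cov_mx P (fun w => ols A1 (Y1 w)) in
  forall i : 'I_k, (V11 i i <= V00 i i)%E.
Proof.
move=> _ _ rkA0 A1 lm1 unc var0 var_last lt_var Y0 V00 V11 i.
have freeA0 : row_free A0^T by rewrite /row_free mxrank_tr rkA0.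
have SigmaE : Sigma11 = block_mx (sigma1 ^+ 2)%:M 0 0 (sigma_last ^+ 2)%:M.
  (* [Y1] and [eps1] differ by the constant [A1 *m beta]. *)
  have covY : cov_mx P Y1 = map_mx EFin Sigma11.
    rewrite -(lm_cov lm1) -(cov_mx_addl (A1 *m beta) (lm_L2 lm1)).
    by congr cov_mx; apply/funext => w; rewrite (lm_eq lm1).
  have SE r c : covariance P (rv_coord Y1 r) (rv_coord Y1 c)
      = (Sigma11 r c)%:E.
    by move/matrixP/(_ r c): covY; rewrite !mxE.
  have Soff r c : r != c -> Sigma11 r c = 0.
    by move=> rc; apply: EFin_inj; rewrite -SE unc.
  rewrite -[LHS]submxK; congr block_mx; apply/matrixP => r c; rewrite !mxE.
  - have [->|rc] := eqVneq r c; last first.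
      by rewrite Soff// (inj_eq (@lshift_inj _ _)).
    by apply: EFin_inj; rewrite -SE -/(variance _ _) var0.
  - by rewrite Soff// eq_lrshift.
  - by rewrite Soff// eq_rlshift.
  - by apply: EFin_inj; rewrite -SE !ord1 -/(variance _ _) var_last.
rewrite /V00 /V11 (cov_mx_ols lm1) (cov_mx_ols (linear_model_usub lm1)).
rewrite SigmaE block_mxKul [leLHS]mxE [leRHS]mxE lee_fin -subr_ge0.
have /matrixP/(_ i i) :=
  ols_variance_gap a (sigma1 ^+ 2) (sigma_last ^+ 2) freeA0.
rewrite [LHS]mxE [X in _ + X = _]mxE => ->.
rewrite mxE [X in _ <= X + _]mxE [X in _ <= _ + X]mxE.
have w_ge0 : 0 <= sigma1 ^+ 2 *+ 2 - sigma_last ^+ 2.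
  by rewrite subr_ge0 mulr2n ler_wpDl ?sqr_ge0// ltW.
by apply: addr_ge0; apply: mulr_ge0; rewrite ?sqr_ge0// mulmx_trmx_diag_ge0.
Qed.
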